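(* Let $d,s,p\in\mathbb{N}$, $A\in\mathbb{C}^{d\times d}$, $x_0\in\mathbb{C}^d$, $t_0,t\in\mathbb{C}$ with $t\neq t_0$, and consider the initial value problem $\dot{x}(t)=Ax$, $x(t_0)=x_0$. Let $\gamma^*:[0,1]\to\mathbb{C}$ be the path $$\gamma^*(x):=\frac{t_0-t}{2i\sin\left(\frac{\pi}{p+1}\right)}\left[e^{i\pi\left(\frac{1-2x}{p+1}\right)}-\cos\left(\frac{\pi}{p+1}\right)\right]+\frac{t_0+t}{2}.$$ For $n\in\mathbb{N}$ let $x_{\Delta_n^{\gamma^*}}$ be the grid function generated by an $s$-stage Runge-Kutta method of order $p$ applied to this problem along the time grid $\Delta_n^{\gamma^*}$, and let $\delta_n:=\max_{0\le j\le n-1}\left|\gamma^*\left(\frac{j+1}{n}\right)-\gamma^*\left(\frac{j}{n}\right)\right|$. Then $$t_0=\gamma^*(0)\quad\text{and}\quad t=\gamma^*(1),$$ and furthermore $$\lim_{n\to\infty}\frac{e^{(t-t_0)A}x_0-x_{\Delta_n^{\gamma^*}}(t)}{\delta_n^p}=0.$$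
   Context: For a path $\gamma:[0,1]\to\mathbb{C}$ and $n\in\mathbb{N}$, $\Delta_n^\gamma=[t_0,\dots,t_n]$ with $t_j=\gamma(j/n)$ is the associated time grid; its steps $t_{j+1}-t_j$ are complex numbers. An $s$-stage Runge-Kutta method (explicit or implicit) with coefficients $\mathfrak{A}\in\mathbb{C}^{s\times s}$, $\mathfrak{b},\mathfrak{c}\in\mathbb{C}^s$ applied to $\dot{x}=Ax$ has the one-step map $\Psi^{t+\tau,t}x=x+\tau\sum_{i=1}^s\mathfrak{b}_ik_i$, where $k_i=Ax+\tau\sum_{j=1}^{s}\mathfrak{A}_{i,j}Ak_j$, $\tau\in\mathbb{C}$; it is explicit if $\mathfrak{A}$ is strictly lower triangular. In the implicit case the one-step map is defined for $|\tau|$ sufficiently small, hence the grid function is defined for all sufficiently large $n$. The method has order $p$ in the usual sense: for sufficiently smooth right-hand sides the consistency error (exact flow minus one numerical step of size $\tau$) is $\mathcal{O}(|\tau|^{p+1})$ as $\tau\to0$. The grid function is $x_\Delta(t_0)=x_0$, $x_\Delta(t_{j+1})=\Psi^{t_{j+1},t_j}x_\Delta(t_j)$, defined recursively along the index $j$; $x_{\Delta_n^{\gamma^*}}(t)$ is its value at the last grid point $t_n=t$. *)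

(* Defs.v *)
From HB Require Import structures.
From mathcomp Require Import all_boot all_order all_algebra.
From mathcomp Require Import all_classical all_reals all_analysis.
From mathcomp Require Export complex.

Set Implicit Arguments.
Unset Strict Implicit.
Unset Printing Implicit Defensive.

Import Order.TTheory GRing.Theory Num.Theory.
Import numFieldNormedType.Exports.

Local Open Scope classical_set_scope.
Local Open Scope ring_scope.
Local Open Scope complex_scope.

(* Topology and norm of the complex plane, those of any [numFieldType]. *)
HB.instance Definition _ (R : realType) := NormedModule.copy R[i] R[i]^o.

Definition cexp (R : realType) (z : R[i]) : R[i] :=
  (expR (complex.Re z))%:C * (cos (complex.Im z) +i* sin (complex.Im z)).

(* The limit is taken in the max-norm topology of matrices; the series always
   converges, so the totalized [limn] is never a junk value. *)
Definition mexp (R : realType) (d : nat) (M : 'M[R[i]]_d) : 'M[R[i]]_d :=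
  limn (series (fun k : nat => (k`!%:R)^-1 *: M ^+ k)).

Record rk_method (R : realType) (s : nat) := RKMethod {
  rk_A : 'M[R[i]]_s;
  rk_b : 'cV[R[i]]_s;
  rk_c : 'cV[R[i]]_s
}.

(* Column [i] of [K] is the stage k_i of one step of complex size [tau] from
   the point [x] at time [t], for the differential equation x' = f(t, x). No
   triangularity is imposed on [rk_A], so these are implicit equations. *)
Definition rk_stages (R : realType) (s D : nat) (m : rk_method R s)
    (f : R[i] -> 'cV[R[i]]_D -> 'cV[R[i]]_D)
    (t tau : R[i]) (x : 'cV[R[i]]_D) (K : 'M[R[i]]_(D, s)) : Prop :=
  forall i : 'I_s,
    col i K = f (t + rk_c m i 0 * tau)
                (x + tau *: \sum_(j < s) rk_A m i j *: col j K).

Definition rk_update (R : realType) (s D : nat) (m : rk_method R s)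
    (tau : R[i]) (x : 'cV[R[i]]_D) (K : 'M[R[i]]_(D, s)) : 'cV[R[i]]_D :=
  x + tau *: \sum_(i < s) rk_b m i 0 *: col i K.

(* Order (at least) p. Time, state and step size being complex, a smooth
   right-hand side is a holomorphic one, i.e. a complex Frechet-differentiable
   one. For an implicit method and a nonlinear f, the stage equations may have
   several solutions; the numerical step is the one obtained from the implicit
   function theorem, namely the branch [K] that is continuous at tau = 0
   (unique as a germ at 0). *)
Definition rk_has_order (R : realType) (s : nat) (m : rk_method R s)
    (p : nat) : Prop :=
  forall (D : nat) (f : R[i] -> 'cV[R[i]]_D -> 'cV[R[i]]_D)
    (t0 : R[i]) (x0 : 'cV[R[i]]_D)
    (x : R[i] -> 'cV[R[i]]_D) (K : R[i] -> 'M[R[i]]_(D, s)),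
  (\forall z \near (t0, x0),
     differentiable (fun w : R[i] * 'cV[R[i]]_D => f w.1 w.2) z) ->
  x t0 = x0 ->
  (\forall t \near t0, is_derive (t : R[i]) 1 x (f t (x t))) ->
  {for (0 : R[i]), continuous K} ->
  (\forall tau \near (0 : R[i]), rk_stages m f t0 tau x0 (K tau)) ->
  (fun tau : R[i] => x (t0 + tau) - rk_update m tau x0 (K tau))
    =O_ (0 : R[i]) (fun tau : R[i] => tau ^+ p.+1).

(* One-step map for x' = A x. For an implicit method it is meaningful for small
   |tau| only, where the (linear) stage equations have exactly one solution,
   which [get] selects; it is a junk value if there is no solution. *)
Definition rk_step (R : realType) (s d : nat) (m : rk_method R s)
    (A : 'M[R[i]]_d) (t tau : R[i]) (x : 'cV[R[i]]_d) : 'cV[R[i]]_d :=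
  rk_update m tau x
    (get [set K : 'M[R[i]]_(d, s) | rk_stages m (fun=> mulmx A) t tau x K]).

Definition time_grid (R : realType) (gamma : R -> R[i]) (n j : nat) : R[i] :=
  gamma (j%:R / n%:R).

Fixpoint grid_function (R : realType) (s d : nat) (m : rk_method R s)
    (A : 'M[R[i]]_d) (grid : nat -> R[i]) (x0 : 'cV[R[i]]_d) (j : nat) :
    'cV[R[i]]_d :=
  if j is i.+1
  then rk_step m A (grid i) (grid i.+1 - grid i) (grid_function m A grid x0 i)
  else x0.

(* The norm of R[i] takes its (real) values in R[i], hence the [Re]. *)
Definition max_step (R : realType) (grid : nat -> R[i]) (n : nat) : R :=
  \big[Num.max/0]_(j < n) complex.Re `|grid j.+1 - grid j|.

Definition gamma_star (R : realType) (p : nat) (t0 t : R[i]) (x : R) : R[i] :=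
  (t0 - t) / (2 * 'i * (sin (pi / p.+1%:R))%:C)
    * (cexp ('i * (pi * ((1 - 2 * x) / p.+1%:R))%:C)
       - (cos (pi / p.+1%:R))%:C)
  + (t0 + t) / 2.

(* Main.v *)
Require Import Defs.
From HB Require Import structures.
From mathcomp Require Import all_boot all_order all_algebra.
From mathcomp Require Import all_classical all_reals all_analysis.
From mathcomp Require Import complex.
From mathcomp Require Import ring lra.

(** The scheme is driven by the local error expansion on the linear problem.
    One step of size [tau] from [x] equals, up to [O(|tau| ^ (p + 2))],

      [exp (tau A) x - c tau ^ (p + 1) A ^ (p + 1) x]

    with a constant [c] that depends on the method alone. Transporting all local
    errors to the end point with the exact flow, which commutes with [A], the
    global error becomes

      [c (h_0 ^ (p + 1) + ... + h_(n-1) ^ (p + 1)) A ^ (p + 1) exp ((t - t0) A) x0]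

    plus [n] terms of size [O(delta ^ (p + 2))], that is [O(delta ^ (p + 1))]
    because [n * delta] stays bounded ([global_error]). The path is an arc of a
    circle with central angle [2 pi / (p + 1)], so the [n] steps have equal length
    and each is the previous one turned by [- 2 pi / (n (p + 1))]. Their
    [(p + 1)]-st powers are then proportional to the [n]-th roots of unity, their
    sum vanishes ([arc_steps_sum0]), and one order of convergence is gained.

    The expansion comes from two independent facts. The stage equations read
    [K = K0 + tau L K] for a linear map [L]; they are uniquely solvable for
    small [tau], and unrolling them gives the Taylor polynomial of the step with
    coefficients [rk_weight m k * A ^ k] and a controlled remainder
    ([rk_step_expansion]). That these weights are [1 / k!] for [k <= p]
    ([order_conditions]) follows by testing the definition of order on one
    problem only, the nilpotent system [x_r' = x_(r-1)] in dimension [p + 1]: flow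
    and method are polynomial there, with [k]-th coefficients [1 / k!] and
    [rk_weight m k] on the [k]-th coordinate.

    The matrix exponential is compared with its partial sums through explicit
    tails of the real exponential series ([mexp_tail]); this also gives its
    morphism property ([mexpD]), the error of the truncated product being
    dominated by the same error for real numbers. *)

Set Implicit Arguments.
Unset Strict Implicit.
Unset Printing Implicit Defensive.

Import Order.TTheory GRing.Theory Num.Theory.
Import numFieldNormedType.Exports.

Local Open Scope classical_set_scope.
Local Open Scope ring_scope.
Local Open Scope complex_scope.

(** * The modulus as a real number, and the entrywise norm *)

Definition cmod (R : realType) (z : R[i]) : R := complex.Re `|z|.

Section Modulus.
Context {R : realType}.
Implicit Types z w : R[i].

Lemma normr_cmod z : `|z| = (cmod z)%:C.
Proof. by rewrite /cmod RRe_real// ger0_real. Qed.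

Lemma cmod_ge0 z : 0 <= cmod z.
Proof. by rewrite -lecR -normr_cmod; exact: normr_ge0. Qed.

Lemma cmod0 : cmod (0 : R[i]) = 0.
Proof. by rewrite /cmod normr0. Qed.

Lemma cmod1 : cmod (1 : R[i]) = 1.
Proof. by rewrite /cmod normr1. Qed.

Lemma cmod_eq0 z : cmod z = 0 -> z = 0.
Proof. by move=> z0; apply/eqP; rewrite -normr_eq0 normr_cmod z0. Qed.

Lemma cmodM z w : cmod (z * w) = cmod z * cmod w.
Proof. by apply: (@complexI R); rewrite -normr_cmod normrM !normr_cmod rmorphM. Qed.

Lemma cmodX z n : cmod (z ^+ n) = cmod z ^+ n.
Proof. by apply: (@complexI R); rewrite -normr_cmod normrX !normr_cmod rmorphXn. Qed.

Lemma cmodV z : cmod z^-1 = (cmod z)^-1.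
Proof. by apply: (@complexI R); rewrite -normr_cmod normfV !normr_cmod fmorphV. Qed.

Lemma cmodN z : cmod (- z) = cmod z.
Proof. by rewrite /cmod normrN. Qed.

Lemma cmodD z w : cmod (z + w) <= cmod z + cmod w.
Proof. by rewrite -lecR rmorphD /= -!normr_cmod ler_normD. Qed.

Lemma cmodC (x : R) : cmod x%:C = `|x|.
Proof. by rewrite /cmod normc_def /= expr0n /= addr0 sqrtr_sqr. Qed.

Lemma cmod_nat (n : nat) : cmod (n%:R : R[i]) = n%:R.
Proof. by rewrite -(rmorph_nat (@real_complex R)) cmodC normr_nat. Qed.

Lemma cmod_sum (I : Type) (r : seq I) (P : pred I) (F : I -> R[i]) :
  cmod (\sum_(i <- r | P i) F i) <= \sum_(i <- r | P i) cmod (F i).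
Proof.
elim/big_rec2 : _ => [|i y x _ le_xy]; first by rewrite cmod0.
by rewrite (le_trans (cmodD _ _))// lerD2l.
Qed.

Lemma Re_le_cmod z : `|complex.Re z| <= cmod z.
Proof. by rewrite -lecR -normr_cmod normc_ge_Re. Qed.

Lemma Im_le_cmod z : `|complex.Im z| <= cmod z.
Proof.
rewrite -sqrtr_sqr /cmod normc_def /= ler_sqrt ?lerDr ?sqr_ge0//.
by rewrite addr_ge0 ?sqr_ge0.
Qed.

Lemma cmod_le_ReIm z : cmod z <= `|complex.Re z| + `|complex.Im z|.
Proof.
case: z => x y /=; have -> : (x +i* y) = x%:C + 'i * y%:C by simpc.
rewrite (le_trans (cmodD _ _))// cmodM !cmodC lerD2l.
suff -> : cmod ('i : R[i]) = 1 by rewrite mul1r.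
by rewrite /cmod normc_def /= expr0n expr1n /= add0r sqrtr1.
Qed.

End Modulus.

(** Max-norm convergence of complex matrices is what has to be shown, but its
    values are complex numbers; this equivalent norm takes values in [R], where
    the order is total. *)
Definition entry_norm (R : realType) (m n : nat) (M : 'M[R[i]]_(m, n)) : R :=
  \sum_i \sum_j cmod (M i j).

Section MatrixNorm.
Context {R : realType}.

Lemma entry_norm_ge0 m n (M : 'M[R[i]]_(m, n)) : 0 <= entry_norm M.
Proof. by do 2! apply: sumr_ge0 => ? _; exact: cmod_ge0. Qed.

Lemma cmod_le_entry_norm m n (M : 'M[R[i]]_(m, n)) i j : cmod (M i j) <= entry_norm M.
Proof.
rewrite /entry_norm (bigD1 i)//= (bigD1 j)//= -addrA lerDl addr_ge0//.
  by apply: sumr_ge0 => *; exact: cmod_ge0.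
by do 2! apply: sumr_ge0 => *; exact: cmod_ge0.
Qed.

Lemma entry_norm0 m n : entry_norm (0 : 'M[R[i]]_(m, n)) = 0.
Proof. by rewrite /entry_norm; do 2! apply: big1 => ? _; rewrite mxE cmod0. Qed.

Lemma entry_norm_eq0 m n (M : 'M[R[i]]_(m, n)) : entry_norm M <= 0 -> M = 0.
Proof.
move=> M0; apply/matrixP => i j; rewrite mxE; apply: cmod_eq0; apply/eqP.
by rewrite eq_le cmod_ge0 (le_trans (cmod_le_entry_norm M i j)).
Qed.

Lemma entry_normN m n (M : 'M[R[i]]_(m, n)) : entry_norm (- M) = entry_norm M.
Proof. by do 2! apply: eq_bigr => ? _; rewrite mxE cmodN. Qed.

Lemma entry_normD m n (M N : 'M[R[i]]_(m, n)) :
  entry_norm (M + N) <= entry_norm M + entry_norm N.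
Proof.
rewrite /entry_norm -big_split /=; apply: ler_sum => i _; rewrite -big_split /=.
by apply: ler_sum => j _; rewrite mxE cmodD.
Qed.

Lemma entry_normB m n (M N : 'M[R[i]]_(m, n)) :
  entry_norm (M - N) <= entry_norm M + entry_norm N.
Proof. by rewrite (le_trans (entry_normD _ _))// entry_normN. Qed.

Lemma entry_norm_subC m n (M N : 'M[R[i]]_(m, n)) : entry_norm (M - N) = entry_norm (N - M).
Proof. by rewrite -entry_normN opprB. Qed.

Lemma entry_normZ m n (z : R[i]) (M : 'M[R[i]]_(m, n)) :
  entry_norm (z *: M) = cmod z * entry_norm M.
Proof.
rewrite /entry_norm mulr_sumr; apply: eq_bigr => i _; rewrite mulr_sumr.
by apply: eq_bigr => j _; rewrite mxE cmodM.
Qed.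

Lemma entry_norm_sum m n (I : Type) (r : seq I) (P : pred I) (F : I -> 'M[R[i]]_(m, n)) :
  entry_norm (\sum_(i <- r | P i) F i) <= \sum_(i <- r | P i) entry_norm (F i).
Proof.
elim/big_rec2 : _ => [|i y x _ le_xy]; first by rewrite entry_norm0.
by rewrite (le_trans (entry_normD _ _))// lerD2l.
Qed.

(** The entrywise sum is submultiplicative across all rectangular shapes, which
    is why it replaces the max norm of matrices in every estimate. *)
Lemma entry_normM m n l (M : 'M[R[i]]_(m, n)) (N : 'M[R[i]]_(n, l)) :
  entry_norm (M *m N) <= entry_norm M * entry_norm N.
Proof.
rewrite /entry_norm mulr_suml; apply: ler_sum => i _.
apply: (@le_trans _ _ (\sum_k \sum_j cmod (M i j) * cmod (N j k))).
  apply: ler_sum => k _; rewrite mxE (le_trans (cmod_sum _ _ _))//.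
  by apply: ler_sum => j _; rewrite cmodM.
rewrite exchange_big /= mulr_suml; apply: ler_sum => j _.
rewrite -mulr_sumr ler_wpM2l ?cmod_ge0//.
by rewrite (bigD1 j)//= lerDl; do 2! apply: sumr_ge0 => *; exact: cmod_ge0.
Qed.

Lemma entry_norm1 d : entry_norm (1 : 'M[R[i]]_d) = d%:R.
Proof.
rewrite /entry_norm -[in RHS](card_ord d) -sumr_const; apply: eq_bigr => i _.
rewrite (bigD1 i)//= mxE eqxx mulr1n cmod1 big1 ?addr0// => j ji.
by rewrite mxE eq_sym (negPf ji) mulr0n cmod0.
Qed.

Lemma entry_normX d (M : 'M[R[i]]_d) k : entry_norm (M ^+ k) <= d%:R * entry_norm M ^+ k.
Proof.
elim: k => [|k IH]; first by rewrite !expr0 mulr1 entry_norm1.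
rewrite exprSr [in leRHS]exprSr mulrA (le_trans (entry_normM _ _))//.
by rewrite ler_wpM2r ?entry_norm_ge0.
Qed.

(** Dominates the max norm, hence controls the matrix topology. *)
Lemma cvg_entry_norm m n (u : nat -> 'M[R[i]]_(m, n)) (L : 'M[R[i]]_(m, n)) :
  entry_norm (L - u k) @[k --> \oo] --> (0 : R) -> u @ \oo --> L.
Proof.
move=> uL; apply/cvgrPdist_le => /= e e0.
have [er e_eq] : exists er : R, e = er%:C.
  by exists (complex.Re e); rewrite RRe_real// gtr0_real.
have er0 : 0 < er by rewrite -ltcR -e_eq.
near=> k.
have le_e : entry_norm (L - u k) <= er.
  rewrite -[leLHS]ger0_norm ?entry_norm_ge0// -normrN -sub0r.
  by near: k; exact: ((cvgrPdist_le _ _).1 uL _ er0).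
rewrite [leLHS]/Num.Def.normr /= mx_normE.
have ge0 : 0 <= e by rewrite ltW.
have -> : e = (NngNum ge0)%:num by [].
rewrite num_le; apply/bigmax_leP; split => //= -[a b] _.
rewrite -num_le /= normr_cmod e_eq lecR.
exact: le_trans (cmod_le_entry_norm _ a b) _.
Unshelve. all: by end_near. Qed.

End MatrixNorm.

(** * The matrix exponential *)

Section RealTail.
Context {R : realType}.

Lemma cvg_sum_seq (I : Type) (r : seq I) (f : nat -> I -> R) (l : I -> R) :
  (forall i, f n i @[n --> \oo] --> l i) ->
  \sum_(i <- r) f n i @[n --> \oo] --> \sum_(i <- r) l i.
Proof.
move=> fl; elim: r => [|i r IH].
  have -> : (fun n => \sum_(i <- [::]) f n i) = cst 0.
    by apply/funext => n; rewrite big_nil.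
  by rewrite big_nil; exact: cvg_cst.
have -> : (fun n => \sum_(j <- i :: r) f n j) =
    (fun n => f n i + \sum_(j <- r) f n j).
  by apply/funext => n; rewrite big_cons.
by rewrite big_cons; exact: cvgD.
Qed.

Lemma le0_of_cvg0 (x : R) (e : nat -> R) :
  (forall n, x <= e n) -> e @ \oo --> (0 : R) -> x <= 0.
Proof.
move=> xe e0; have <- := cvg_lim (@Rhausdorff R) e0.
by apply: limr_ge; [apply/cvg_ex; exists 0|near=> n; exact: xe].
Unshelve. all: by end_near. Qed.

(** Dividing the tail of the exponential series by the power [x ^+ K] leaves a
    series dominated term by term by the exponential series itself, since
    [j! <= (j + K)!]. *)
Lemma expR_tail (x : R) K : 0 <= x ->
  expR x - series (exp_coeff x) K <= x ^+ K * expR x.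
Proof.
move=> x0; rewrite lerBlDl.
have cv := is_cvg_series_exp_coeff x.
have le_part n : series (exp_coeff x) n <= expR x.
  apply: nondecreasing_cvgn_le => //.
  by apply/nondecreasing_seqP => k; rewrite /series /= big_nat_recr//= lerDl exp_coeff_ge0.
apply: limr_le => //; near=> n.
have Kn : (K <= n)%N by near: n; exact: nbhs_infty_ge.
rewrite /series /= (big_cat_nat (leq0n K) Kn)//= lerD2l.
rewrite -{1}[K]add0n big_addn.
apply: (@le_trans _ _ (x ^+ K * series (exp_coeff x) (n - K)%N)); last first.
  by rewrite ler_wpM2l ?exprn_ge0.
rewrite /series /= mulr_sumr; apply: ler_sum => k _.
rewrite /exp_coeff /= mulrA -exprD addnC ler_wpM2l ?exprn_ge0//.
by rewrite lef_pV2 ?posrE ?ltr0n ?fact_gt0// ler_nat leq_fact// leq_addl.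
Unshelve. all: by end_near. Qed.

End RealTail.

(** Weierstrass test with an explicit remainder. Completeness is only used for
    the real and imaginary parts of each entry; the remainder of the majorant
    bounds that of the matrix series because it bounds every finite block. *)
Lemma cvg_series_entry_norm (R : realType) m n (u : nat -> 'M[R[i]]_(m, n))
    (v : nat -> R) : cvgn (series v) -> (forall k, entry_norm (u k) <= v k) ->
  exists L, forall N, entry_norm (L - series u N) <= limn (series v) - series v N.
Proof.
move=> cv le_uv.
have v0 k : 0 <= v k by exact: le_trans (entry_norm_ge0 _) (le_uv k).
have le_v N : series v N <= limn (series v).
  apply: nondecreasing_cvgn_le => //.
  by apply/nondecreasing_seqP => k; rewrite /series /= big_nat_recr//= lerDl.
have cvR i j : cvgn (series (fun k => complex.Re (u k i j))).
  apply: normed_cvg; apply: (series_le_cvg _ v0 _ cv) => k /=; first exact: normr_ge0.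
  by rewrite (le_trans (Re_le_cmod _))// (le_trans (cmod_le_entry_norm _ i j)).
have cvI i j : cvgn (series (fun k => complex.Im (u k i j))).
  apply: normed_cvg; apply: (series_le_cvg _ v0 _ cv) => k /=; first exact: normr_ge0.
  by rewrite (le_trans (Im_le_cmod _))// (le_trans (cmod_le_entry_norm _ i j)).
pose lR i j := limn (series (fun k => complex.Re (u k i j))).
pose lI i j := limn (series (fun k => complex.Im (u k i j))).
exists (\matrix_(i, j) (lR i j +i* lI i j)).
set L := \matrix_(i, j) _.
have L_lim : entry_norm (L - series u N) @[N --> \oo] --> (0 : R).
  pose e N := \sum_i \sum_j
    (`|lR i j - series (fun k => complex.Re (u k i j)) N| +
     `|lI i j - series (fun k => complex.Im (u k i j)) N|).
  have e0 : e N @[N --> \oo] --> (0 : R).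
    have -> : (0 : R) = \sum_(i < m) \sum_(j < n)
        (`|lR i j - lR i j| + `|lI i j - lI i j|).
      by rewrite big1// => i _; rewrite big1// => j _; rewrite !subrr normr0 addr0.
    apply: cvg_sum_seq => i; apply: cvg_sum_seq => j.
    apply: cvgD; apply: cvg_norm; apply: cvgB; first exact: cvg_cst.
    - exact: cvR.
    - exact: cvg_cst.
    - exact: cvI.
  apply: (squeeze_cvgr _ (cvg_cst 0) e0); near=> N.
  rewrite entry_norm_ge0 /= /entry_norm /e; apply: ler_sum => i _; apply: ler_sum => j _.
  rewrite (le_trans (cmod_le_ReIm _))// !mxE /series /= summxE.
  by rewrite !(raddfB (@complex.Re R)) !(raddfB (@complex.Im R)) !raddf_sum.
move=> N; rewrite -subr_le0.
apply: (le0_of_cvg0 (e := fun k => entry_norm (L - series u (N + k)%N))); last first.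
  under eq_fun do rewrite addnC.
  by move: L_lim; rewrite -(cvg_shiftn N).
move=> k; rewrite lerBlDr.
have -> : L - series u N = (L - series u (N + k)%N) + (series u (N + k)%N - series u N).
  by rewrite addrA subrK.
rewrite (le_trans (entry_normD _ _))// lerD2l.
rewrite [in leLHS]sub_series leq_addr.
rewrite (le_trans (entry_norm_sum _ _ _))//.
apply: (@le_trans _ _ (series v (N + k)%N - series v N)); last by rewrite lerB.
by rewrite sub_series leq_addr; apply: ler_sum => *.
Unshelve. all: by end_near. Qed.

Definition mexp_term (R : realType) d (M : 'M[R[i]]_d) (k : nat) : 'M[R[i]]_d :=
  (k`!%:R)^-1 *: M ^+ k.

Section Mexp.
Context {R : realType} {d : nat}.
Implicit Types M N : 'M[R[i]]_d.

Lemma entry_norm_mexp_term M k :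
  entry_norm (mexp_term M k) <= d%:R * exp_coeff (entry_norm M) k.
Proof.
rewrite entry_normZ cmodV cmod_nat /exp_coeff /= mulrA mulrC.
by rewrite ler_wpM2r ?invr_ge0// entry_normX.
Qed.

Lemma series_scale (c : R) (u : nat -> R) n :
  series (fun k => c * u k) n = c * series u n.
Proof. by rewrite /series /= mulr_sumr. Qed.

(** Every estimate on the exponential is read off from this one: the remainder
    is at most that of the real exponential, the factor [d] being the norm of the
    identity. *)
Lemma mexp_tail M n : entry_norm (mexp M - series (mexp_term M) n) <=
  d%:R * (expR (entry_norm M) - series (exp_coeff (entry_norm M)) n).
Proof.
pose v k := d%:R * exp_coeff (entry_norm M) k.
have vE : series v = (fun n => d%:R * series (exp_coeff (entry_norm M)) n).
  by apply/funext => k; rewrite series_scale.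
have cv : series v @ \oo --> d%:R * expR (entry_norm M).
  by rewrite vE; apply: cvgMr; exact: is_cvg_series_exp_coeff.
have limv := cvg_lim (@Rhausdorff R) cv.
have [|L LP] := cvg_series_entry_norm _ (entry_norm_mexp_term M).
  by apply/cvg_ex; eexists; exact: cv.
have -> : mexp M = L.
  apply: (@cvg_lim _ (@norm_hausdorff _ _)); apply: cvg_entry_norm.
  apply: (@squeeze_cvgr _ _ _ _ (fun=> 0) (fun k => limn (series v) - series v k)).
  - by near=> k; rewrite entry_norm_ge0 LP.
  - exact: cvg_cst.
  - by rewrite -(subrr (limn (series v))); apply: cvgB; [exact: cvg_cst|rewrite limv].
by rewrite (le_trans (LP n))// limv vE mulrBr.
Unshelve. all: by end_near. Qed.

Lemma mexp_tail_cvg M :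
  d%:R * (expR (entry_norm M) - series (exp_coeff (entry_norm M)) n) @[n --> \oo] --> (0 : R).
Proof.
rewrite -(mulr0 d%:R) -(subrr (expR (entry_norm M))).
by apply: cvgMr; apply: cvgB; [exact: cvg_cst|exact: is_cvg_series_exp_coeff].
Qed.

Lemma mexp_tail_pow M K : entry_norm (mexp M - series (mexp_term M) K) <=
  d%:R * (entry_norm M ^+ K * expR (entry_norm M)).
Proof.
by rewrite (le_trans (mexp_tail M K))// ler_wpM2l// expR_tail ?entry_norm_ge0.
Qed.

Lemma entry_norm_mexp M : entry_norm (mexp M) <= d%:R * expR (entry_norm M).
Proof.
have := mexp_tail_pow M 0.
by rewrite /series /= big_nil subr0 expr0 mul1r.
Qed.

Lemma mexp0 : mexp (0 : 'M[R[i]]_d) = 1.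
Proof.
have := mexp_tail_pow 0 1.
rewrite entry_norm0 expr1 mul0r mulr0 /series /= big_nat1 /mexp_term expr0 fact0.
by rewrite invr1 scale1r => /entry_norm_eq0/eqP; rewrite subr_eq0 => /eqP.
Qed.

(** Commutation passes from the partial sums to the limit. *)
Lemma mulmx_mexp_comm M N : GRing.comm M N -> M *m mexp N = mexp N *m M.
Proof.
move=> MN; apply/eqP; rewrite -subr_eq0; apply/eqP; apply: entry_norm_eq0.
pose e n := d%:R * (expR (entry_norm N) - series (exp_coeff (entry_norm N)) n).
apply: (le0_of_cvg0 (e := fun n => (entry_norm M + entry_norm M) * e n)); last first.
  by rewrite -(mulr0 (entry_norm M + entry_norm M)); apply: cvgMr; exact: mexp_tail_cvg.
move=> n; have comm_part : M *m series (mexp_term N) n = series (mexp_term N) n *m M.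
  rewrite /series /= mulmx_sumr mulmx_suml; apply: eq_bigr => k _.
  by rewrite -scalemxAr -scalemxAl; congr (_ *: _); exact: commrX.
have -> : M *m mexp N - mexp N *m M = M *m (mexp N - series (mexp_term N) n) -
    (mexp N - series (mexp_term N) n) *m M.
  by rewrite mulmxBr mulmxBl comm_part opprB addrA subrK.
rewrite (le_trans (entry_normB _ _))// mulrDl lerD// (le_trans (entry_normM _ _))//.
  by rewrite ler_wpM2l ?entry_norm_ge0// mexp_tail.
by rewrite mulrC ler_wpM2l ?entry_norm_ge0// mexp_tail.
Qed.

End Mexp.

(** * Additivity of the matrix exponential *)

Section CauchyProduct.

(** The square of index pairs splits into the antidiagonals it contains in
    full and a remainder; the remainder is the only obstruction to the
    truncated exponential being a morphism. *)
Lemma cauchy_product_nat (T : pzRingType) (u v : nat -> T) n :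
  (\sum_(0 <= i < n) u i) * (\sum_(0 <= j < n) v j) =
  \sum_(0 <= k < n) \sum_(0 <= i < k.+1) u i * v (k - i)%N +
  \sum_(0 <= i < n) \sum_(n - i <= j < n) u i * v j.
Proof.
have -> : \sum_(0 <= k < n) \sum_(0 <= i < k.+1) u i * v (k - i)%N =
    \sum_(0 <= i < n) \sum_(0 <= j < n - i) u i * v j.
  transitivity (\sum_(0 <= k < n) \sum_(0 <= i < n | (i < k.+1)%N) u i * v (k - i)%N).
    by apply: eq_big_nat => k /andP[_ kn]; rewrite (big_nat_widen 0 _ n).
  rewrite (exchange_big_dep_nat predT)//=; apply: eq_bigr => i _.
  rewrite -(big_nat_widenl i 0 n xpredT (fun k => u i * v (k - i)%N))//.
  rewrite -{1}(add0n i) big_addn; apply: eq_bigr => j _.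
  by rewrite addnK.
rewrite -big_split mulr_suml /=; apply: eq_bigr => i _.
by rewrite -(big_cat_nat (leq0n _) (leq_subr i n)) mulr_sumr.
Qed.
End CauchyProduct.

Lemma fact_inv_bin (F : numFieldType) k i : (i <= k)%N ->
  (k`!%:R)^-1 * 'C(k, i)%:R = (i`!%:R)^-1 * ((k - i)`!%:R)^-1 :> F.
Proof.
move=> ik; rewrite -(bin_fact ik) !natrM !invfM mulrAC mulVf ?mul1r//.
by rewrite pnatr_eq0 -lt0n bin_gt0.
Qed.

Section Semigroup.
Context {R : realType}.

Lemma exp_coeffD (x y : R) k : exp_coeff (x + y) k =
  \sum_(0 <= i < k.+1) exp_coeff x i * exp_coeff y (k - i)%N.
Proof.
rewrite /exp_coeff /= addrC exprDn mulr_suml big_mkord; apply: eq_bigr => i _.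
rewrite -mulr_natr -[LHS]mulrA ['C(k, i)%:R * _]mulrC fact_inv_bin -1?ltnS//.
by rewrite [y ^+ _ * x ^+ _]mulrC mulrACA.
Qed.

Lemma mexp_termD d (M N : 'M[R[i]]_d) k : GRing.comm M N -> mexp_term (M + N) k =
  \sum_(0 <= i < k.+1) mexp_term M i * mexp_term N (k - i)%N.
Proof.
move=> MN; rewrite /mexp_term addrC exprDn_comm; last exact: commr_sym.
rewrite scaler_sumr big_mkord; apply: eq_bigr => i _.
rewrite -(scaler_nat 'C(k, i)) scalerA fact_inv_bin -1?ltnS//.
rewrite -[RHS]scalemxAl -scalemxAr scalerA; congr (_ *: _).
exact/commrX/commr_sym/commrX/commr_sym.
Qed.

(** The defect of multiplicativity of the partial sums consists of the products
    of terms outside the full antidiagonals. The same pairs make up the defect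
    for the real exponential, which therefore bounds it. *)
Lemma mexp_partM_le d (M N : 'M[R[i]]_d) n : GRing.comm M N ->
  entry_norm (series (mexp_term M) n *m series (mexp_term N) n -
          series (mexp_term (M + N)) n) <=
  d%:R ^+ 2 * (series (exp_coeff (entry_norm M)) n * series (exp_coeff (entry_norm N)) n -
               series (exp_coeff (entry_norm M + entry_norm N)) n).
Proof.
move=> MN; rewrite /series /=.
rewrite [_ *m _]cauchy_product_nat [in leRHS]cauchy_product_nat.
under [X in _ - X]eq_bigr do rewrite mexp_termD//.
under [X in _ <= _ * (_ - X)]eq_bigr do rewrite exp_coeffD//.
rewrite ![_ + _ - _]addrAC !subrr !add0r mulr_sumr (le_trans (entry_norm_sum _ _ _))//.
apply: ler_sum => i _; rewrite mulr_sumr (le_trans (entry_norm_sum _ _ _))//.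
apply: ler_sum => j _; rewrite (le_trans (entry_normM _ _))// expr2 mulrACA.
by rewrite ler_pM ?entry_norm_ge0 ?entry_norm_mexp_term.
Qed.

Lemma mexpD d (M N : 'M[R[i]]_d) : GRing.comm M N ->
  mexp (M + N) = mexp M *m mexp N.
Proof.
move=> MN; apply/eqP; rewrite eq_sym -subr_eq0; apply/eqP; apply: entry_norm_eq0.
set x := entry_norm M; set y := entry_norm N.
pose S := fun (z : R) n => series (exp_coeff z) n.
pose t (K : 'M[R[i]]_d) n := d%:R * (expR (entry_norm K) - S (entry_norm K) n).
pose e n := t M n * entry_norm (mexp N) + entry_norm (mexp M) * t N n + t M n * t N n +
  d%:R ^+ 2 * (S x n * S y n - S (x + y) n) + t (M + N) n.
have Sl z : S z n @[n --> \oo] --> expR z by exact: is_cvg_series_exp_coeff.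
have tl K : t K n @[n --> \oo] --> (0 : R) by exact: mexp_tail_cvg.
apply: (le0_of_cvg0 (e := e)); last first.
  have -> : (0 : R) = 0 * entry_norm (mexp N) + entry_norm (mexp M) * 0 + 0 * 0 +
      d%:R ^+ 2 * (expR x * expR y - expR (x + y)) + 0.
    by rewrite expRD subrr !(mul0r, mulr0, addr0).
  apply: cvgD; last exact: tl.
  apply: cvgD; last by apply: cvgMr; apply: cvgB; [apply: cvgM|]; exact: Sl.
  apply: cvgD; last by apply: cvgM; exact: tl.
  by apply: cvgD; [apply: cvgMl|apply: cvgMr]; exact: tl.
move=> n; rewrite /e.
set P := fun K : 'M[R[i]]_d => series (mexp_term K) n.
have -> : mexp M *m mexp N - mexp (M + N) =
    (mexp M - P M) *m mexp N + P M *m (mexp N - P N) + (P M *m P N - P (M + N)) -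
    (mexp (M + N) - P (M + N)).
  by rewrite mulmxBl mulmxBr opprB !addrA !subrK.
have tE K : entry_norm (mexp K - P K) <= t K n by exact: mexp_tail.
have PM : entry_norm (P M) <= entry_norm (mexp M) + t M n.
  rewrite -[P M](subKr (mexp M)) (le_trans (entry_normB _ _))// lerD2l.
  exact: tE.
rewrite (le_trans (entry_normB _ _))// lerD ?tE//.
rewrite (le_trans (entry_normD _ _))// lerD ?mexp_partM_le//.
rewrite -addrA -mulrDl (le_trans (entry_normD _ _))// lerD//.
  by rewrite (le_trans (entry_normM _ _))// ler_wpM2r ?entry_norm_ge0 ?tE.
by rewrite (le_trans (entry_normM _ _))// ler_pM ?entry_norm_ge0 ?tE.
Qed.

End Semigroup.

(** * The circular arc *)

Section Circle.
Context {R : realType}.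

Definition cis (a : R) : R[i] := cos a +i* sin a.

Lemma cexp_im (a : R) : cexp ('i * a%:C) = cis a.
Proof.
rewrite /cexp; have -> : 'i * a%:C = 0 +i* a :> R[i] by simpc.
by rewrite /= expR0 mul1r.
Qed.

Lemma cisD (a b : R) : cis (a + b) = cis a * cis b.
Proof. by rewrite /cis cosD sinD; simpc; congr (_ +i* _); rewrite addrC. Qed.

Lemma cis0 : cis 0 = 1.
Proof. by rewrite /cis cos0 sin0. Qed.

Lemma cisMn (a : R) n : cis (a *+ n) = cis a ^+ n.
Proof. by elim: n => [|n IH]; rewrite ?mulr0n ?cis0// mulrSr cisD IH exprSr. Qed.

Lemma cmod_cis (a : R) : cmod (cis a) = 1.
Proof. by rewrite /cmod normc_def /= cos2Dsin2 sqrtr1. Qed.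

(** Used for sine and cosine, to bound a chord of the circle by its angle. *)
Lemma lipschitz_of_derive (f df : R -> R) (a : R) :
  (forall x : R, is_derive x 1 f (df x)) -> (forall x, `|df x| <= 1) -> 0 <= a ->
  `|f a - f 0| <= a.
Proof.
move=> fdf df1 a0.
have [|c _ ->] := MVT_segment a0 (fun x _ => fdf x).
  apply: continuous_subspaceT => x; apply: differentiable_continuous.
  by apply/derivable1_diffP; exact: ex_derive.
by rewrite subr0 normrM [X in _ * X]ger0_norm// ler_piMl.
Qed.

Lemma cmod_cis_sub1 (a : R) : 0 <= a -> cmod (cis a - 1) <= 2 * a.
Proof.
move=> a0; rewrite (le_trans (cmod_le_ReIm _))// mulr_natl mulr2n lerD//=.
  rewrite -[X in _ - X]cos0; apply: (lipschitz_of_derive (df := fun x => - sin x)) => // x.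
  by rewrite normrN sin_max.
rewrite -[X in _ - X]sin0; apply: (lipschitz_of_derive (df := cos)) => // x.
exact: cos_max.
Qed.

Lemma cis_neq1 (a : R) : 0 < a -> a <= pi -> cis a != 1.
Proof.
move=> a0 api; apply/eqP => -[cos1 _].
have := @ltr_cos R 0 a; rewrite !in_itv /= pi_ge0 lexx (ltW a0) api cos0 cos1 ltxx.
by move=> /(_ isT isT); rewrite a0.
Qed.

Lemma sum_roots_of_unity (z : R[i]) n : z != 1 -> z ^+ n = 1 ->
  \sum_(j < n) z ^+ j = 0.
Proof.
move=> z1 zn; have /eqP := subrX1 z n.
by rewrite zn subrr eq_sym mulf_eq0 subr_eq0 (negPf z1) => /eqP.
Qed.

End Circle.

Section Arc.
Context {R : realType}.
Context (p : nat) (t0 t : R[i]) (p_gt0 : (0 < p)%N).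

Let q : R := p.+1%:R.
Let k : R[i] := (t0 - t) / (2 * 'i * (sin (pi / q))%:C).

Lemma arc_sin_neq0 : sin (pi / q) != 0.
Proof.
rewrite gt_eqF// sin_gt0_pi// divr_gt0 ?pi_gt0 ?ltr0n//=.
by rewrite ltr_pdivrMr ?ltr0n// ltr_pMr ?pi_gt0// ltr1n.
Qed.

Lemma gamma_starE x : gamma_star p t0 t x =
  k * (cis (pi * ((1 - 2 * x) / q)) - (cos (pi / q))%:C) + (t0 + t) / 2.
Proof. by rewrite /gamma_star cexp_im. Qed.

(** The factor [k] is chosen for this identity: it scales and turns the chord of
    the unit circle of half-length [sin (pi / q)] onto the segment from [t0] to
    [t]. *)
Lemma arc_halfchord : k * ('i * (sin (pi / q))%:C) = (t0 - t) / 2.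
Proof.
have i0 : 'i != 0 :> R[i] by rewrite eq_complex /= oner_eq0 andbF.
have s0 : (sin (pi / q))%:C != 0 :> R[i].
  by apply/eqP => /(@complexI R)/eqP; rewrite (negPf arc_sin_neq0).
by rewrite /k; field; rewrite i0 s0.
Qed.

Lemma gamma_star0 : gamma_star p t0 t 0 = t0.
Proof.
rewrite gamma_starE mulr0 subr0 mul1r /cis.
have -> : (cos (pi / q) +i* sin (pi / q)) - (cos (pi / q))%:C =
    'i * (sin (pi / q))%:C :> R[i].
  by apply/eqP; rewrite eq_complex /=; apply/andP; split; apply/eqP; ring.
by rewrite arc_halfchord; field.
Qed.

Lemma gamma_star1 : gamma_star p t0 t 1 = t.
Proof.
rewrite gamma_starE mulr1.
have -> : pi * ((1 - 2) / q) = - (pi / q) by rewrite mulrA; field.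
rewrite /cis cosN sinN.
have -> : (cos (pi / q) +i* - sin (pi / q)) - (cos (pi / q))%:C =
    - ('i * (sin (pi / q))%:C) :> R[i].
  by apply/eqP; rewrite eq_complex /=; apply/andP; split; apply/eqP; ring.
by rewrite mulrN arc_halfchord; field.
Qed.

Let b n : R := 2 * pi / (n%:R * q).

(** Equidistant parameters are equidistant angles on the circle carrying the
    path, so consecutive steps differ by a fixed rotation. *)
Lemma arc_step n j : (0 < n)%N ->
  time_grid (gamma_star p t0 t) n j.+1 - time_grid (gamma_star p t0 t) n j =
  (- k * cis (pi / q - b n) * (cis (b n) - 1)) * cis (- b n) ^+ j.
Proof.
move=> n0; rewrite /time_grid !gamma_starE.
have q0 : q != 0 by rewrite pnatr_eq0.
have nz : n%:R != 0 :> R by rewrite pnatr_eq0 -lt0n.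
have -> : pi * ((1 - 2 * (j.+1%:R / n%:R)) / q) = (pi / q - b n) + (- b n) *+ j.
  rewrite /b mulNrn -mulr_natr -[j.+1]addn1 natrD.
  by move: (q) q0 => q' q0; field; rewrite nz q0.
have -> : pi * ((1 - 2 * (j%:R / n%:R)) / q) = (pi / q - b n) + (- b n) *+ j + b n.
  by rewrite /b mulNrn -mulr_natr; move: (q) q0 => q' q0; field; rewrite nz q0.
rewrite !cisD cisMn; ring.
Qed.

(** The turning angle between consecutive steps is [2 pi / (n * p.+1)]: the
    [p.+1]-st powers of the steps are, up to a common factor, all the [n]-th roots
    of unity. *)
Lemma arc_steps_sum0 n : (1 < n)%N ->
  \sum_(j < n) (time_grid (gamma_star p t0 t) n j.+1 -
                time_grid (gamma_star p t0 t) n j) ^+ p.+1 = 0.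
Proof.
move=> n1; have n0 : (0 < n)%N by exact: ltnW.
have q0 : q != 0 by rewrite pnatr_eq0.
have nz : n%:R != 0 :> R by rewrite pnatr_eq0 -lt0n.
under eq_bigr do rewrite arc_step// exprMn -exprM mulnC exprM.
rewrite -mulr_sumr sum_roots_of_unity ?mulr0//.
- rewrite -cisMn; have -> : - b n *+ p.+1 = - (2 * pi / n%:R).
    by rewrite -(mulr_natr (- b n)) /b -/q; move: (q) q0 => q' q0; field; rewrite nz q0.
  have b_gt0 : 0 < 2 * pi / n%:R :> R by rewrite divr_gt0 ?mulr_gt0 ?pi_gt0 ?ltr0n.
  have b_le : 2 * pi / n%:R <= pi :> R.
    by rewrite ler_pdivrMr ?ltr0n// [leRHS]mulrC ler_pM2r ?pi_gt0// ler_nat.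
  move: (cis_neq1 b_gt0 b_le).
  apply: contra => /eqP c1.
  by rewrite -(mulr1 (cis _)) -c1 -cisD subrr cis0 c1.
- rewrite -!cisMn; have -> : - b n *+ p.+1 *+ n = - (pi *+ 2).
    rewrite -(mulr_natr (- b n)) -(mulr_natr (_ * _)) -(mulr_natr pi) /b -/q.
    by move: (q) q0 => q' q0; field; rewrite nz q0.
  by rewrite /cis cosN sinN cos2pi sin2pi oppr0.
Qed.

Lemma arc_step_cmod n j : (0 < n)%N ->
  cmod (time_grid (gamma_star p t0 t) n j.+1 - time_grid (gamma_star p t0 t) n j)
  = max_step (time_grid (gamma_star p t0 t) n) n.
Proof.
move=> n0.
set grid := time_grid _ n.
have cmodE i : cmod (grid i.+1 - grid i) = cmod (- k * cis (pi / q - b n) * (cis (b n) - 1)).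
  by rewrite arc_step// cmodM cmodX cmod_cis expr1n mulr1.
rewrite cmodE; apply/eqP; rewrite eq_le; apply/andP; split.
  rewrite -(cmodE 0%N) /max_step.
  pose step (i : 'I_n) := complex.Re `|grid i.+1 - grid i|.
  exact: (@le_bigmax _ _ _ _ step (Ordinal n0)).
apply/bigmax_leP; split; first exact: cmod_ge0.
by move=> i _; rewrite -[leLHS]/(cmod _) cmodE.
Qed.

(** The arc has radius [cmod k] and angle [2 pi / q]; the additional factor [2] is
    lost when the chord is bounded by the angle. *)
Lemma arc_max_step_le n : (0 < n)%N ->
  max_step (time_grid (gamma_star p t0 t) n) n * n%:R <= cmod k * (2 * (2 * pi / q)).
Proof.
move=> n0; have q0 : 0 < q by rewrite ltr0n.
have nz : 0 < n%:R :> R by rewrite ltr0n.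
rewrite -(arc_step_cmod 0 n0) arc_step// expr0 mulr1; move: (k) => k'.
rewrite !cmodM cmodN cmod_cis mulr1.
rewrite -[leLHS]mulrA ler_wpM2l ?cmod_ge0// -ler_pdivlMr// (le_trans (cmod_cis_sub1 _))//.
  by rewrite divr_ge0 ?mulr_ge0 ?pi_ge0 ?ltW.
by rewrite /b invfM le_eqVlt; apply/orP; left; apply/eqP; ring.
Qed.

End Arc.

(** * One step on a linear problem *)

Section Step.
Context {R : realType} {s d : nat}.
Context (m : rk_method R s) (A : 'M[R[i]]_d).

(** The linear part of the stage equations, with the stages as columns. *)
Definition stage_map (K : 'M[R[i]]_(d, s)) : 'M[R[i]]_(d, s) :=
  A *m K *m (rk_A m)^T.

(** The Taylor coefficients at [0] of the stability function of the method. *)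
Definition rk_weight (k : nat) : R[i] :=
  if k is k'.+1 then
    (((const_mx 1 : 'rV_s) *m ((rk_A m)^T ^+ k')) *m rk_b m) 0 0
  else 1.

Lemma rk_updateE tau (x : 'cV[R[i]]_d) K :
  rk_update m tau x K = x + tau *: (K *m rk_b m).
Proof.
congr (_ + _ *: _); apply/colP => i; rewrite summxE mxE.
by apply: eq_bigr => j _; rewrite !mxE mulrC.
Qed.

Lemma rk_stagesE t tau x K :
  rk_stages m (fun=> mulmx A) t tau x K <->
  K = A *m x *m const_mx 1 + tau *: stage_map K.
Proof.
have colE i : col i (A *m x *m const_mx 1 + tau *: stage_map K) =
   A *m (x + tau *: \sum_(j < s) rk_A m i j *: col j K).
  rewrite mulmxDr -scalemxAr raddfD /= linearZ /=; congr (_ + _ *: _).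
    by apply/colP => a; rewrite !mxE big_ord1 !mxE mulr1.
  apply/colP => a; rewrite mxE /stage_map -mulmxA mxE [in RHS]mxE.
  apply: eq_bigr => b _; congr (_ * _); rewrite summxE mxE.
  by apply: eq_bigr => j _; rewrite !mxE mulrC.
split=> [KE|KE i]; last by rewrite [in LHS]KE colE.
apply/matrixP => a i; by move/colP/(_ a): (KE i); rewrite -colE [LHS]mxE [RHS]mxE.
Qed.

Lemma entry_norm_stage_map K :
  entry_norm (stage_map K) <= entry_norm A * entry_norm (rk_A m)^T * entry_norm K.
Proof.
rewrite (le_trans (entry_normM _ _))// mulrAC ler_wpM2r ?entry_norm_ge0//.
exact: entry_normM.
Qed.

Lemma stage_mapD K L : stage_map (K + L) = stage_map K + stage_map L.
Proof. by rewrite /stage_map mulmxDr mulmxDl. Qed.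

Lemma stage_mapZ a K : stage_map (a *: K) = a *: stage_map K.
Proof. by rewrite /stage_map -scalemxAr -scalemxAl. Qed.

(** Makes [tau *: stage_map] a contraction with factor [1 / 2]. *)
Definition small_step (tau : R[i]) :=
  cmod tau * (entry_norm A * entry_norm (rk_A m)^T) <= 2^-1.

Lemma stage_bound tau K0 K : small_step tau ->
  K = K0 + tau *: stage_map K -> entry_norm K <= 2 * entry_norm K0.
Proof.
move=> small KE.
have : entry_norm K <= entry_norm K0 + 2^-1 * entry_norm K.
  rewrite {1}KE (le_trans (entry_normD _ _))// lerD2l entry_normZ.
  rewrite (le_trans (ler_wpM2l (cmod_ge0 _) (entry_norm_stage_map K)))//.
  by rewrite mulrA ler_wpM2r ?entry_norm_ge0.
by lra.
Qed.

(** In finite dimension the stage equations are solvable as soon as they have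
    at most one solution, and the contraction estimate gives the latter. *)
Lemma stage_exists tau K0 : small_step tau ->
  exists K, K = K0 + tau *: stage_map K.
Proof.
move=> small.
have lin : linear (fun K => K - tau *: stage_map K).
  move=> a K L; rewrite stage_mapD stage_mapZ scalerBr scalerDr !scalerA.
  by rewrite [tau * a]mulrC opprD !addrA; congr (_ - _); rewrite addrAC.
pose fL := GRing.isLinear.Build _ _ _ _ _ lin.
pose f : {linear 'M[R[i]]_(d, s) -> 'M[R[i]]_(d, s)} :=
  HB.pack (fun K => K - tau *: stage_map K) fL.
have ker0 : lker (linfun f) == 0%VS.
  rewrite -subv0; apply/subvP => K; rewrite memv_ker lfunE /= memv0 subr_eq0 => /eqP KE.
  apply/eqP/entry_norm_eq0; rewrite -(mulr0 2) -(@entry_norm0 R d s).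
  by apply: (stage_bound small); rewrite add0r.
exists ((linfun f)^-1%VF K0).
by have := lker0_lfunVK ker0 K0; rewrite lfunE /= => /eqP; rewrite subr_eq => /eqP {1}<-.
Qed.

(** Starting from the rank one matrix of constant stages [A *m x], the iterates
    keep rank one: [A] acts on the column factor and the method on the row
    factor, which is how the coefficients [rk_weight] decouple from [A]. *)
Lemma iter_stage_map_rank1 k (x : 'cV[R[i]]_d) :
  iter k stage_map (A *m x *m const_mx 1) =
  A ^+ k.+1 *m x *m (const_mx 1 *m (rk_A m)^T ^+ k).
Proof.
elim: k => [|k IH]; first by rewrite /= expr1 expr0 mulmx1.
by rewrite iterS IH /stage_map [_^T ^+ k.+1]exprSr [A ^+ k.+2]exprS !mulmxA.
Qed.

Lemma entry_norm_stage_mapX k K :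
  entry_norm (iter k stage_map K) <=
  (entry_norm A * entry_norm (rk_A m)^T) ^+ k * entry_norm K.
Proof.
elim: k => [|k IH]; first by rewrite expr0 mul1r.
rewrite iterS (le_trans (entry_norm_stage_map _))// exprS -[leRHS]mulrA ler_wpM2l//.
by rewrite mulr_ge0 ?entry_norm_ge0.
Qed.

Lemma iter_stage_mapD k K L :
  iter k stage_map (K + L) = iter k stage_map K + iter k stage_map L.
Proof. by elim: k => //= k ->; rewrite stage_mapD. Qed.

Lemma iter_stage_mapZ k a K : iter k stage_map (a *: K) = a *: iter k stage_map K.
Proof. by elim: k => //= k ->; rewrite stage_mapZ. Qed.

(** Neumann expansion of the fixed point, with its exact remainder. *)
Lemma stage_expansion tau K0 K n : K = K0 + tau *: stage_map K ->
  K = \sum_(0 <= k < n) tau ^+ k *: iter k stage_map K0 +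
      tau ^+ n *: iter n stage_map K.
Proof.
move=> KE; elim: n => [|n IH]; first by rewrite big_nil expr0 scale1r add0r.
rewrite {1}IH {1}KE big_nat_recr//= -addrA; congr (_ + _).
by rewrite iter_stage_mapD iter_stage_mapZ scalerDr scalerA -exprSr -iterSr.
Qed.

(** The constant is uniform in the point and the step: the remainder of the
    Neumann expansion is linear in the stages, which are bounded by twice the
    constant ones. *)
Lemma rk_step_expansion n : exists2 C, 0 <= C & forall t tau x, small_step tau ->
  entry_norm (rk_step m A t tau x -
    \sum_(0 <= k < n.+1) (tau ^+ k * rk_weight k) *: (A ^+ k *m x)) <=
  C * cmod tau ^+ n.+1 * entry_norm x.
Proof.
set a := entry_norm A * entry_norm (rk_A m)^T.
exists (a ^+ n * (2 * (entry_norm A * entry_norm (const_mx 1 : 'rV[R[i]]_s))) *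
   entry_norm (rk_b m)).
  by rewrite !mulr_ge0 ?exprn_ge0 ?mulr_ge0 ?entry_norm_ge0.
move=> t tau x small.
have [K KP] : exists K, rk_stages m (fun=> mulmx A) t tau x K.
  have [K KE] := stage_exists (A *m x *m const_mx 1) small.
  by exists K; apply/rk_stagesE.
rewrite /rk_step; set K' := get _.
have /rk_stagesE KE : rk_stages m (fun=> mulmx A) t tau x K'.
  pose sols := [set K : 'M[R[i]]_(d, s) | rk_stages m (fun=> mulmx A) t tau x K].
  exact: (@getPex _ sols (ex_intro _ K KP)).
rewrite rk_updateE big_nat_recl//= expr0 mulr1 scale1r mul1mx [x + _]addrC opprD addrA addrK.
rewrite [in X in X - _](stage_expansion n KE).
rewrite mulmxDl scalerDr addrAC.
have -> : tau *: ((\sum_(0 <= k < n) tau ^+ k *: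
      iter k stage_map (A *m x *m const_mx 1)) *m rk_b m) =
   \sum_(0 <= i < n) (tau ^+ i.+1 *
         ((const_mx 1 : 'rV[R[i]]_s) *m (rk_A m)^T ^+ i *m rk_b m) 0 0) *: (A ^+ i.+1 *m x).
  rewrite mulmx_suml scaler_sumr; apply: eq_bigr => k _.
  rewrite -scalemxAl !scalerA -exprS iter_stage_map_rank1 -[RHS]scalerA; congr (_ *: _).
  rewrite -mulmxA [X in _ *m X]mx11_scalar mul_mx_scalar.
  by [].
rewrite subrr add0r -scalemxAl scalerA -exprS entry_normZ cmodX.
rewrite [leRHS]mulrAC [leRHS]mulrC ler_wpM2l ?exprn_ge0 ?cmod_ge0//.
rewrite (le_trans (entry_normM _ _))// [leRHS]mulrAC ler_wpM2r ?entry_norm_ge0//.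
rewrite (le_trans (entry_norm_stage_mapX _ _))// -mulrA.
rewrite ler_wpM2l ?exprn_ge0 ?mulr_ge0 ?entry_norm_ge0//.
rewrite (le_trans (stage_bound small KE))// -[leRHS]mulrA ler_wpM2l//.
rewrite (le_trans (entry_normM _ _))// mulrAC ler_wpM2r ?entry_norm_ge0//.
exact: entry_normM.
Qed.

End Step.

(** * Holomorphic vector polynomials *)

Section VectorPolynomials.
Context {R : realType}.

(** The product rule against a constant vector, whatever normed module it lives
    in; both the exact solution and the stages of the test problem are
    combinations of such products. *)
Lemma is_derive_scalev (V : normedModType R[i]) (g : R[i] -> R[i]) (dg : R[i])
    (C : V) (t : R[i]) :
  is_derive (t : R[i]) (1 : R[i]) g dg ->
  is_derive (t : R[i]) (1 : R[i]) (fun z : R[i] => g z *: C) (dg *: C).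
Proof.
move=> [dg1 dgE].
have gl : (fun h : R[i] => h^-1 *: ((g \o shift t) (h *: (1 : R[i])) - g t)) @ 0^' --> dg.
  by rewrite -dgE; exact: dg1.
pose quot (h : R[i]) :=
  h^-1 *: (((fun z => g z *: C) \o shift t) (h *: (1 : R[i])) - g t *: C).
have Cl : quot @ 0^' --> dg *: C.
  have -> : quot =
     (fun h : R[i] => (h^-1 *: ((g \o shift t) (h *: (1 : R[i])) - g t)) *: C).
    by apply/funext => h; rewrite /quot /= -scalerBl scalerA.
  by apply: cvgZ => //; exact: cvg_cst.
apply: DeriveDef; first by apply/cvg_ex; eexists; exact: Cl.
exact: (cvg_lim (@norm_hausdorff _ _) Cl).
Qed.

Lemma is_derive_monomial (V : normedModType R[i]) (C : V) n (t : R[i]) :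
  is_derive (t : R[i]) (1 : R[i]) (fun z : R[i] => z ^+ n *: C) ((n%:R * t ^+ n.-1) *: C).
Proof.
apply: is_derive_scalev.
have := is_deriveX n (is_derive_id t (1 : R[i])).
have -> : id ^+ n = (fun z : R[i] => z ^+ n).
  by apply/funext => z; rewrite exprfctE.
by move=> h; apply: is_derive_eq; rewrite /GRing.scale /= mulr1.
Qed.

Lemma is_derive_vpoly (V : normedModType R[i]) (C : nat -> V) n (t : R[i]) :
  is_derive (t : R[i]) (1 : R[i]) (fun z : R[i] => \sum_(k < n) z ^+ k *: C k)
    (\sum_(k < n) (k%:R * t ^+ k.-1) *: C k).
Proof.
have := is_derive_sum (fun k : 'I_n => is_derive_monomial (C k) k t).
rewrite (_ : (fun z => _) = \sum_(k < n) (fun z : R[i] => z ^+ k *: C k))//.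
by apply/funext => z; rewrite fct_sumE.
Qed.

Lemma continuous_vpoly (V : normedModType R[i]) (C : nat -> V) n (t : R[i]) :
  {for t, continuous (fun z : R[i] => \sum_(k < n) z ^+ k *: C k)}.
Proof.
apply: differentiable_continuous; apply/derivable1_diffP.
have := is_derive_vpoly C n t; move=> h; exact: ex_derive.
Qed.
Lemma differentiable_mulmx_snd D (N : 'M[R[i]]_D) (w : R[i] * 'cV[R[i]]_D) :
  differentiable (fun w : R[i] * 'cV[R[i]]_D => N *m w.2) w.
Proof.
have -> : (fun w : R[i] * 'cV[R[i]]_D => N *m w.2) =
    \sum_(j < D) (fun w : R[i] * 'cV[R[i]]_D => (w.2 j 0 : R[i]) *: col j N).
  apply/funext => u; rewrite fct_sumE; apply/colP => a.
  rewrite !mxE summxE; apply: eq_bigr => j _; by rewrite !mxE mulrC.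
apply: differentiable_sum => j.
have snd_lin : linear (snd : R[i] * 'cV[R[i]]_D -> 'cV[R[i]]_D) by [].
pose fL := GRing.isLinear.Build _ _ _ _ _ snd_lin.
pose f : {linear (R[i] * 'cV[R[i]]_D)%type -> 'cV[R[i]]_D} :=
  HB.pack (snd : R[i] * 'cV[R[i]]_D -> 'cV[R[i]]_D) fL.
have fd : differentiable f w by apply: linear_differentiable => u; exact: cvg_snd.
have cd := differentiable_comp fd (differentiable_coord (f w) j 0).
exact: (differentiableZl (col j N) cd).
Qed.
End VectorPolynomials.

(** * Order conditions *)

Section OrderConditions.
Context {R : realType}.

Definition shift_mx (D : nat) : 'M[R[i]]_D := \matrix_(r, c) (r == c.+1 :> nat)%:R.
(** The index is a natural number, so that [unit_col D k] is [0] beyond the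
    dimension and the shift acts on these columns without a boundary case. *)
Definition unit_col (D k : nat) : 'cV[R[i]]_D := \col_r (r == k :> nat)%:R.

Lemma shift_unit_col D k : shift_mx D *m unit_col D k = unit_col D k.+1.
Proof.
apply/colP => r; rewrite !mxE.
have [kD|kD] := ltnP k D.
  rewrite (bigD1 (Ordinal kD))//= !mxE eqxx mulr1 big1 ?addr0// => j jk.
  by rewrite !mxE [j == k :> nat](negPf (contra_neq _ jk)) ?mulr0// => jk'; exact: val_inj.
rewrite big1 => [|j _]; last first.
  by rewrite !mxE [j == k :> nat]ltn_eqF ?mulr0// (leq_trans (ltn_ord j)).
by rewrite ltn_eqF// ltnS (leq_trans (ltnW (ltn_ord r))).
Qed.

Lemma unit_col_out D k : (D <= k)%N -> unit_col D k = 0.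
Proof.
by move=> Dk; apply/colP => r; rewrite !mxE ltn_eqF// (leq_trans (ltn_ord r)).
Qed.

(** Dividing by [r ^+ k] leaves [cmod c <= C * r] for all small [r <= 1], so a
    monomial of degree at most [p] cannot be of order [p.+1] without vanishing. *)
Lemma monomial_bigO_eq0 (c : R[i]) (k p : nat) (rho C : R) : (k <= p)%N -> 0 < rho ->
  (forall r : R, 0 < r -> r < rho -> cmod c * r ^+ k <= C * r ^+ p.+1) -> c = 0.
Proof.
move=> kp rho0 cC; apply: cmod_eq0; apply/eqP; rewrite eq_le cmod_ge0 andbT leNgt.
apply/negP => c0.
have C1 : 0 < `|C| + 1 by rewrite ltr_wpDl.
pose r := Num.min (Num.min (rho / 2) 1) (cmod c / 2 / (`|C| + 1)).
have r0 : 0 < r by rewrite !lt_min !divr_gt0 ?ltr01.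
have r1 : r <= 1 by rewrite /r !ge_min lexx orbT.
have rrho : r < rho.
  by rewrite /r !gt_min ltr_pdivrMr// ltr_pMr// ltr1n.
have rc : r <= cmod c / 2 / (`|C| + 1) by rewrite /r !ge_min lexx !orbT.
have := cC r r0 rrho; rewrite -(subnK (leqW kp)) exprD mulrA ler_pM2r ?exprn_gt0//.
rewrite subSn// exprS => cle.
have : cmod c <= cmod c / 2.
  rewrite (le_trans cle)//.
  apply: (@le_trans _ _ ((`|C| + 1) * r)); last by rewrite mulrC -ler_pdivlMr.
  rewrite (le_trans (ler_norm _))// normrM ler_pM// ?lerDl//.
  rewrite (@ger0_norm _ (r * _)) ?mulr_ge0 ?exprn_ge0 ?(ltW r0)// ler_piMr ?(ltW r0)//.
  by rewrite exprn_ile1 ?(ltW r0).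
by move: c0; lra.
Qed.

Lemma coord_le_mx_norm (n l : nat) (M : 'M[R[i]]_(n, l)) i j : `|M i j| <= `|M|.
Proof.
rewrite [leRHS]/Num.Def.normr /= mx_normE -[leLHS]/((NngNum (normr_ge0 (M i j)))%:num).
rewrite num_le.
exact: (@le_bigmax _ _ _ _ (fun ij : 'I_n * 'I_l => `|M ij.1 ij.2|%:nng) (i, j)).
Qed.

(** The problem [x' = shift_mx D *m x] with [D = p.+1] is the smallest one that
    sees all the coefficients up to degree [p]. Since the shift is nilpotent, the
    exact solution and the stages are polynomials in the step, and no
    exponential is needed. *)
Lemma order_conditions (s p : nat) (m : rk_method R s) : rk_has_order m p ->
  forall k, (k <= p)%N -> rk_weight m k = (k`!%:R)^-1.
Proof.
move=> hm k0 k0p.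
pose D := p.+1.
pose x := fun t : R[i] => \sum_(k < D) t ^+ k *: ((k`!%:R)^-1 *: unit_col D k).
pose g k : 'rV[R[i]]_s := const_mx 1 *m ((rk_A m)^T ^+ k).
pose K := fun t : R[i] => \sum_(k < D) t ^+ k *: (unit_col D k.+1 *m g k).
have x_at0 : x 0 = unit_col D 0.
  rewrite /x /D big_ord_recl expr0 fact0 invr1 !scale1r big1 ?addr0// => k _.
  by rewrite expr0n scale0r.
(* The sum over [D.+1] indices has one more term, on [unit_col D D.+1 = 0]; it
   makes the shift of the summation index exact. *)
have stageK t tau : rk_stages m (fun=> mulmx (shift_mx D)) t tau (unit_col D 0) (K tau).
  apply/rk_stagesE.
  have -> : shift_mx D *m unit_col D 0 *m const_mx 1 +
      tau *: stage_map m (shift_mx D) (K tau) =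
      \sum_(k < D.+1) tau ^+ k *: (unit_col D k.+1 *m g k).
    rewrite big_ord_recl expr0 scale1r /g expr0 mulmx1 shift_unit_col; congr (_ + _).
    rewrite /stage_map /K mulmx_sumr mulmx_suml scaler_sumr; apply: eq_bigr => k _.
    rewrite -scalemxAr -scalemxAl scalerA -exprS; congr (_ *: _).
    by rewrite [shift_mx D *m _]mulmxA shift_unit_col /g lift0 exprSr !mulmxA.
  by rewrite big_ord_recr /= (unit_col_out (leqnSn D)) mul0mx scaler0 addr0.
have upd tau : rk_update m tau (unit_col D 0) (K tau) =
    \sum_(k < D) tau ^+ k *: (rk_weight m k *: unit_col D k).
  rewrite rk_updateE.
  transitivity (\sum_(k < D.+1) tau ^+ k *: (rk_weight m k *: unit_col D k)); last first.
    by rewrite big_ord_recr /= unit_col_out// !scaler0 addr0.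
  rewrite big_ord_recl expr0 !scale1r; congr (_ + _).
  rewrite /K mulmx_suml scaler_sumr; apply: eq_bigr => k _.
  rewrite -scalemxAl scalerA -exprS; congr (_ *: _).
  by rewrite -mulmxA [X in _ *m X]mx11_scalar mul_mx_scalar.
have err tau : x (0 + tau) - rk_update m tau (unit_col D 0) (K tau) =
    \sum_(k < D) tau ^+ k *: (((k`!%:R)^-1 - rk_weight m k) *: unit_col D k).
  rewrite add0r upd -sumrB; apply: eq_bigr => k _.
  by rewrite -scalerBr -scalerBl.
have := hm D (fun=> mulmx (shift_mx D)) 0 (unit_col D 0) x K _ x_at0 _ _ _.
have H1 : \forall z \near ((0 : R[i]), unit_col D 0),
  differentiable (fun w : R[i] * 'cV[R[i]]_D => shift_mx D *m w.2) z.
  by near=> z; exact: differentiable_mulmx_snd.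
have H2 : \forall t \near (0 : R[i]), is_derive (t : R[i]) 1 x (shift_mx D *m x t).
  near=> t.
  have := is_derive_vpoly (fun k => (k`!%:R)^-1 *: unit_col D k) D t.
  move=> h; apply: is_derive_eq.
  rewrite /x mulmx_sumr /D big_ord_recl mul0r scale0r add0r.
  rewrite [RHS]big_ord_recr /= -!scalemxAr shift_unit_col (unit_col_out (leqnn _)).
  rewrite !scaler0 addr0.
  apply: eq_bigr => k _; rewrite -!scalemxAr shift_unit_col !scalerA.
  rewrite /bump leq0n add1n add0n factS natrM invfM.
  congr (_ *: _); rewrite [_.+1%:R * _]mulrC mulrA; congr (_ * _).
  by rewrite -mulrA mulfV ?mulr1// pnatr_eq0.
have H3 : {for (0 : R[i]), continuous K}.
  have cK := @continuous_vpoly _ _ (fun k => unit_col D k.+1 *m g k) D 0.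
  exact: cK.
have H4 : \forall tau \near (0 : R[i]),
    rk_stages m (fun=> mulmx (shift_mx D)) 0 tau (unit_col D 0) (K tau).
  by near=> tau; exact: stageK.
(* Both sides are now polynomials; the [k0]-th coordinate of their difference
   is a single monomial. *)
move=> /(_ H1 H2 H3 H4) /eqO_exP [C [C0 bigO]].
pose c := (k0`!%:R)^-1 - rk_weight m k0.
suff /eqP : c = 0 by rewrite subr_eq0 => /eqP.
have [e e0 eP] := (nbhs_ballP _ _).1 bigO.
have cr z : (0 : R[i]) < z -> exists2 r : R, 0 < r & z = r%:C.
  move=> z0; have zE : z = (complex.Re z)%:C by rewrite RRe_real// gtr0_real.
  by exists (complex.Re z) => //; rewrite -ltcR -zE.
have [rho rho0 eE] := cr _ e0; have [C' C'0 CE] := cr _ C0.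
apply: (monomial_bigO_eq0 (C := C') k0p rho0) => r r0 rrho.
have /= := eP r%:C; rewrite /ball /= sub0r normrN normr_cmod cmodC gtr0_norm// eE ltcR.
move=> /(_ rrho).
rewrite normrX normr_cmod cmodC gtr0_norm// err CE => h.
have k0D : (k0 < D)%N by rewrite ltnS.
have := le_trans (coord_le_mx_norm _ (Ordinal k0D) 0) h.
rewrite summxE (bigD1 (Ordinal k0D))//= big1 => [|k kk0]; last first.
  by rewrite !mxE eq_sym [_ == _ :> nat](negPf kk0) !mulr0.
rewrite addr0 !mxE eqxx mulr1 normr_cmod cmodM cmodX cmodC gtr0_norm// mulrC.
by rewrite -rmorphXn -rmorphM lecR.
Unshelve. all: by end_near. Qed.

End OrderConditions.

(** * Local and global error *)

Lemma subr_regroup (V : zmodType) (a r l s : V) : a - r - l = a - (s + l) - (r - s).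
Proof. by rewrite opprD addrA opprB addrACA subrK addrA addrAC. Qed.

Section Convergence.
Context {R : realType} {s d p : nat}.
Context (m : rk_method R s) (A : 'M[R[i]]_d).

Lemma exprZ_mx (z : R[i]) k : (z *: A) ^+ k = z ^+ k *: A ^+ k.
Proof.
elim: k => [|k IH]; first by rewrite !expr0 scale1r.
by rewrite !exprS IH -[LHS]scalemxAl -scalemxAr scalerA.
Qed.

Lemma flow_near1 : exists2 C, 0 <= C & forall (h : R[i]) (x : 'cV[R[i]]_d),
  cmod h <= 1 -> entry_norm (mexp (h *: A) *m x - x) <= C * cmod h * entry_norm x.
Proof.
exists (d%:R * (entry_norm A * expR (entry_norm A))) => [|h x h1].
  by rewrite !mulr_ge0 ?entry_norm_ge0 ?expR_ge0.
rewrite -{2}[x]mul1mx -mulmxBl (le_trans (entry_normM _ _))// ler_wpM2r ?entry_norm_ge0//.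
have := mexp_tail_pow (h *: A) 1.
rewrite /series /= big_nat1 /mexp_term expr0 fact0 invr1 scale1r expr1 => /le_trans; apply.
rewrite -mulrA ler_wpM2l// entry_normZ -mulrA mulrC ler_wpM2r ?cmod_ge0//.
by rewrite ler_wpM2l ?entry_norm_ge0// ler_expR ler_piMl ?entry_norm_ge0.
Qed.

(** Up to order [p] the flow and the method have the same Taylor coefficients,
    so the local error starts with a multiple of [tau ^+ p.+1 *: A ^+ p.+1]; the
    multiplier [c] does not depend on the point or on the step. *)
Lemma local_error_leading : rk_has_order m p ->
  exists (c : R[i]) (C rho : R), [/\ 0 <= C, 0 < rho <= 1 &
  forall t tau (x : 'cV[R[i]]_d), cmod tau <= rho ->
  entry_norm (mexp (tau *: A) *m x - rk_step m A t tau x -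
          (c * tau ^+ p.+1) *: (A ^+ p.+1 *m x)) <=
  C * cmod tau ^+ p.+2 * entry_norm x].
Proof.
move=> /order_conditions hm.
have [C1 C1_ge0 stepC] := rk_step_expansion m A p.+1.
set al := entry_norm A * entry_norm (rk_A m)^T.
have al_ge0 : 0 <= al by rewrite mulr_ge0 ?entry_norm_ge0.
exists ((p.+1`!%:R)^-1 - rk_weight m p.+1).
exists (d%:R * (entry_norm A ^+ p.+2 * expR (entry_norm A)) + C1).
(* The second bound gives [rho * al <= 1 / 2]; adding [1] covers [al = 0]. *)
exists (Num.min 1 (2 * (al + 1))^-1); split.
- apply: addr_ge0 => //; apply: mulr_ge0 => //; apply: mulr_ge0; last exact: expR_ge0.
  exact/exprn_ge0/entry_norm_ge0.
- apply/andP; split; last by rewrite ge_min lexx.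
  by rewrite lt_min ltr01 invr_gt0 mulr_gt0 ?ltr_wpDl.
move=> t tau x; rewrite le_min => /andP[tau1 tau_al].
have small : small_step m A tau.
  rewrite /small_step -/al; apply: (le_trans (ler_wpM2r al_ge0 tau_al)).
  rewrite invfM -mulrA ler_piMr// ler_pdivrMl ?mulr1 ?ltr_wpDl//.
  by rewrite lerDl.
pose S := \sum_(0 <= k < p.+2) (tau ^+ k * rk_weight m k) *: (A ^+ k *m x).
have -> : mexp (tau *: A) *m x - rk_step m A t tau x -
      ((p.+1`!%:R)^-1 - rk_weight m p.+1) * tau ^+ p.+1 *: (A ^+ p.+1 *m x) =
    (mexp (tau *: A) - series (mexp_term (tau *: A)) p.+2) *m x -
    (rk_step m A t tau x - S).
  have SE : series (mexp_term (tau *: A)) p.+2 *m x =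
     S + (((p.+1`!%:R)^-1 - rk_weight m p.+1) * tau ^+ p.+1) *: (A ^+ p.+1 *m x).
    rewrite /series /= mulmx_suml /S big_nat_recr//= [X in _ = X + _]big_nat_recr//= -addrA.
    congr (_ + _).
      apply: eq_big_nat => k /andP[_ kp]; rewrite hm//.
      by rewrite /mexp_term exprZ_mx -!scalemxAl scalerA mulrC.
    rewrite /mexp_term exprZ_mx -!scalemxAl scalerA -scalerDl; congr (_ *: _).
    by set u := _^-1; ring.
  by rewrite mulmxBl SE; exact: subr_regroup.
rewrite (le_trans (entry_normB _ _))// mulrDl mulrDl lerD ?stepC//.
rewrite (le_trans (entry_normM _ _))// ler_wpM2r ?entry_norm_ge0//.
rewrite (le_trans (mexp_tail_pow _ _))// entry_normZ exprMn.
have -> : d%:R * (entry_norm A ^+ p.+2 * expR (entry_norm A)) * cmod tau ^+ p.+2 =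
    d%:R * (cmod tau ^+ p.+2 * entry_norm A ^+ p.+2 * expR (entry_norm A)) by ring.
rewrite ler_wpM2l//; apply: ler_wpM2l.
  by apply: mulr_ge0; apply: exprn_ge0; [exact: cmod_ge0|exact: entry_norm_ge0].
by rewrite ler_expR ler_piMl ?entry_norm_ge0.
Qed.


Lemma mexp_scaleD (a b : R[i]) : mexp ((a + b) *: A) = mexp (a *: A) *m mexp (b *: A).
Proof.
rewrite scalerDl mexpD// /GRing.comm -[LHS]scalemxAl -[RHS]scalemxAl.
by rewrite -!scalemxAr !scalerA mulrC.
Qed.

Lemma mulmx_pow_mexp (z : R[i]) k : A ^+ k *m mexp (z *: A) = mexp (z *: A) *m A ^+ k.
Proof.
apply: mulmx_mexp_comm; apply/commr_sym/commrX.
by rewrite /GRing.comm -[LHS]scalemxAl -[RHS]scalemxAr.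
Qed.

(** If the [p.+1]-st powers of equally long steps cancel, the leading parts of
    the transported local errors cancel too: to first order they are all
    multiples of the same vector [A ^+ p.+1 *m v 0], with [v 0] the exact value
    at the end point. Substituting that vector for the transported numerical one
    changes each leading part by a relative [O(delta)] only, because the method
    is at least of order one. *)
Lemma global_error (T : R) : rk_has_order m p -> (0 < p)%N -> 0 <= T ->
  exists (C rho : R), 0 < rho /\
  forall (g : nat -> R[i]) (n : nat) (delta : R) (x0 : 'cV[R[i]]_d),
  (forall j, (j < n)%N -> cmod (g j.+1 - g j) = delta) ->
  0 <= delta -> delta <= rho -> delta * n%:R <= T ->
  \sum_(j < n) (g j.+1 - g j) ^+ p.+1 = 0 ->
  entry_norm (mexp ((g n - g 0%N) *: A) *m x0 - grid_function m A g x0 n) <=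
  C * delta ^+ p.+1 * entry_norm x0.
Proof.
move=> hm p0 T0.
have [c [C1 [rho [C1_ge0 /andP[rho0 rho1] locP]]]] := local_error_leading hm.
have [C2 C2_ge0 nearP] := flow_near1.
(* [B] bounds the flow over the whole path, [L] is the stability constant of the
   method along it, [C3] the constant of the full local error, and [C4] that of
   a local error without its leading part. *)
pose B := d%:R * expR (T * entry_norm A).
have B_ge0 : 0 <= B by apply: mulr_ge0 => //; exact: expR_ge0.
pose Dq := cmod c * entry_norm (A ^+ p.+1).
have Dq_ge0 : 0 <= Dq by apply: mulr_ge0; [exact: cmod_ge0|exact: entry_norm_ge0].
pose C3 := C1 + Dq.
have C3_ge0 : 0 <= C3 by exact: addr_ge0.
pose L := expR ((C2 + C3) * T).
pose C4 := B * C1 * L + Dq * (B * C2 * L + T * B * C3 * L).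
exists (T * C4), rho; split=> // g n delta x0 gstep delta0 delta_rho deltaT gsum.
have delta1 : delta <= 1 by exact: le_trans rho1.
pose h j := g j.+1 - g j.
pose E z := mexp (z *: A).
have EA z (y : 'cV[R[i]]_d) : A ^+ p.+1 *m (E z *m y) = E z *m (A ^+ p.+1 *m y).
  by rewrite mulmxA mulmx_pow_mexp -mulmxA.
have E0 : E 0 = 1 by rewrite /E scale0r mexp0.
have E_bound z : entry_norm (E z) <= d%:R * expR (cmod z * entry_norm A).
  by rewrite (le_trans (entry_norm_mexp _))// entry_normZ.
rewrite -/(E (g n - g 0%N)).
have Emul a b (y : 'cV[R[i]]_d) : E (a + b) *m y = E a *m (E b *m y).
  by rewrite /E mexp_scaleD mulmxA.
have : forall j, grid_function m A g x0 j.+1 =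
  rk_step m A (g j) (h j) (grid_function m A g x0 j) by [].
have : grid_function m A g x0 0 = x0 by [].
move: (grid_function m A g x0) => x x_0 xS.
have {}nearP : forall u (y : 'cV[R[i]]_d), cmod u <= 1 ->
  entry_norm (E u *m y - y) <= C2 * cmod u * entry_norm y by exact: nearP.
have {}locP : forall j, (j < n)%N -> entry_norm (E (h j) *m x j - x j.+1 -
    (c * h j ^+ p.+1) *: (A ^+ p.+1 *m x j)) <= C1 * delta ^+ p.+2 * entry_norm (x j).
  by move=> j jn; rewrite xS -(gstep j jn); apply: locP; rewrite gstep.
have {}gstep : forall j, (j < n)%N -> cmod (h j) = delta by [].
have {}gsum : \sum_(j < n) h j ^+ p.+1 = 0 by [].
have hE j : g n - g j = (g n - g j.+1) + h j by rewrite /h addrA subrK.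
have hE' j : g j.+1 - g j = h j by [].
(* Only the properties of the flow and of the numerical solution collected so
   far enter the estimates. *)
move: (A ^+ p.+1) @Dq Dq_ge0 @C3 C3_ge0 @L @C4 EA locP
  => Aq Dq Dq_ge0 C3 C3_ge0 L C4 EA locP.
clearbody E h.
have sub_le j k : (j <= k)%N -> (k <= n)%N -> cmod (g k - g j) <= (k - j)%:R * delta.
  move=> jk kn; rewrite -(telescope_sumr _ jk) (le_trans (cmod_sum _ _ _))//.
  rewrite mulr_natl -sumr_const_nat; apply: ler_sum_nat => i /andP[_ ik].
  by rewrite hE' gstep// (leq_trans ik).
have E_le j : (j <= n)%N -> entry_norm (E (g n - g j)) <= B.
  move=> jn; rewrite (le_trans (E_bound _))// ler_wpM2l// ler_expR.
  rewrite ler_wpM2r ?entry_norm_ge0// (le_trans (sub_le _ _ jn (leqnn n)))//.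
  by rewrite (le_trans _ deltaT)// mulrC ler_wpM2l// ler_nat leq_subr.
have step_err j : (j < n)%N ->
    entry_norm (E (h j) *m x j - x j.+1) <= C3 * delta ^+ p.+1 * entry_norm (x j).
  move=> jn; have loc := locP j jn.
  rewrite -[E (h j) *m x j - _](subrK ((c * h j ^+ p.+1) *: (Aq *m x j))).
  rewrite (le_trans (entry_normD _ _))// mulrDl mulrDl lerD//.
    rewrite (le_trans loc)// ler_wpM2r ?entry_norm_ge0// ler_wpM2l//.
    by rewrite exprS ler_piMl ?exprn_ge0.
  have -> : Dq * delta ^+ p.+1 * entry_norm (x j) =
      cmod c * delta ^+ p.+1 * (entry_norm Aq * entry_norm (x j)) by rewrite /Dq; ring.
  rewrite entry_normZ cmodM cmodX gstep//; apply: ler_wpM2l; last exact: entry_normM.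
  by apply: mulr_ge0; [exact: cmod_ge0|exact: exprn_ge0].
(* A step of the method differs from the identity by [O(delta)], and
   [1 + u <= expR u] turns the product of [n] such factors into [L]. *)
have x_le j : (j <= n)%N -> entry_norm (x j) <= L * entry_norm x0.
  move=> jn.
  apply: (@le_trans _ _ (expR ((C2 + C3) * delta) ^+ j * entry_norm x0)); last first.
    rewrite ler_wpM2r ?entry_norm_ge0// -expRM_natl ler_expR mulrCA ler_wpM2l ?addr_ge0//.
    by rewrite (le_trans _ deltaT)// mulrC ler_wpM2l// ler_nat.
  elim: j jn => [|j IH] jn; first by rewrite expr0 mul1r x_0.
  rewrite exprS -mulrA (le_trans _ (ler_wpM2l (expR_ge0 _) (IH (ltnW jn))))//.
  rewrite (le_trans _ (ler_wpM2r (entry_norm_ge0 _) (expR_ge1Dx _)))//.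
  have -> : x j.+1 = x j + (E (h j) *m x j - x j) - (E (h j) *m x j - x j.+1).
    by rewrite [x j + _]addrC subrK subKr.
  have -> : (1 + (C2 + C3) * delta) * entry_norm (x j) =
      entry_norm (x j) + C2 * delta * entry_norm (x j) + C3 * delta * entry_norm (x j) by ring.
  rewrite (le_trans (entry_normB _ _))//.
  apply: lerD.
    rewrite (le_trans (entry_normD _ _))// lerD2l.
    by have := nearP (h j) (x j); rewrite gstep//; apply.
  rewrite (le_trans (step_err j jn))// ler_wpM2r ?entry_norm_ge0// ler_wpM2l//.
  by rewrite exprS ler_piMr ?exprn_ile1.
pose X := L * entry_norm x0.
have X_ge0 : 0 <= X by apply: mulr_ge0; [exact: expR_ge0|exact: entry_norm_ge0].
(* The value at the end point of the exact flow started from the j-th point. *)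
pose v j := E (g n - g j) *m x j.
have vE j : v j = E (g n - g j.+1) *m (E (h j) *m x j).
  by rewrite -Emul -hE.
have v_step j : (j < n)%N -> entry_norm (v j - v j.+1) <= B * C3 * X * delta ^+ p.+1.
  move=> jn; rewrite vE /v -mulmxBr (le_trans (entry_normM _ _))//.
  have -> : B * C3 * X * delta ^+ p.+1 = B * (C3 * delta ^+ p.+1 * X) by ring.
  apply: ler_pM; rewrite ?entry_norm_ge0 ?E_le// (le_trans (step_err j jn))//.
  by rewrite ler_wpM2l ?mulr_ge0 ?exprn_ge0 ?x_le// ltnW.
have v_far j : (j <= n)%N -> entry_norm (v j - v 0%N) <= T * B * C3 * X * delta.
  move=> jn; rewrite -(telescope_sumr _ (leq0n j)) (le_trans (entry_norm_sum _ _ _))//.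
  apply: (@le_trans _ _ (\sum_(0 <= i < j) B * C3 * X * delta ^+ p.+1)).
    apply: ler_sum_nat => i /andP[_ ij].
    by rewrite entry_norm_subC v_step// (leq_trans ij).
  rewrite sumr_const_nat subn0 -mulr_natl exprS.
  have -> : j%:R * (B * C3 * X * (delta * delta ^+ p)) =
      (delta * j%:R) * (delta ^+ p) * (B * C3 * X) by ring.
  have -> : T * B * C3 * X * delta = T * delta * (B * C3 * X) by ring.
  apply: ler_wpM2r; first by apply: mulr_ge0 => //; exact: mulr_ge0.
  apply: ler_pM => //; [exact: mulr_ge0|exact: exprn_ge0| |].
    by rewrite (le_trans _ deltaT)// ler_wpM2l// ler_nat.
  by rewrite -(prednK p0) exprS ler_piMr ?exprn_ile1.
(* Leading part of the transported local error: first [A ^+ p.+1] is moved past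
   the flow, then the vector it acts on is replaced by [v 0]. *)
have v_lead j : (j < n)%N ->
    entry_norm (v j - v j.+1 - (c * h j ^+ p.+1) *: (Aq *m v 0%N)) <=
    C4 * entry_norm x0 * delta ^+ p.+2.
  move=> jn; have := E_le _ jn; have := vE j.
  have : v j.+1 = E (g n - g j.+1) *m x j.+1 by [].
  move: (g n - g j.+1) (v j) (v j.+1) (v_far j (ltnW jn)) => z a b far bE aE Ez.
  have -> : a - b - (c * h j ^+ p.+1) *: (Aq *m v 0%N) =
     E z *m (E (h j) *m x j - x j.+1 - (c * h j ^+ p.+1) *: (Aq *m x j)) +
     (c * h j ^+ p.+1) *: (Aq *m ((a - v 0%N) - E z *m (E (h j) *m x j - x j))).
    have -> : a - v 0%N - E z *m (E (h j) *m x j - x j) = E z *m x j - v 0%N.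
      by rewrite aE mulmxBr opprB addrC addrA subrK.
    rewrite [Aq *m (_ - _)]mulmxBr (EA z) scalerBr.
    by rewrite [E z *m (_ - _ - _)]mulmxBr -scalemxAr addrA subrK mulmxBr aE bE.
  have -> : C4 * entry_norm x0 * delta ^+ p.+2 = B * (C1 * delta ^+ p.+2 * X) +
     cmod c * delta ^+ p.+1 *
     (entry_norm Aq * (T * B * C3 * X * delta + B * (C2 * delta * X))).
    by rewrite /C4 /Dq /X [delta ^+ p.+2]exprS; ring.
  rewrite (le_trans (entry_normD _ _))// lerD//.
    rewrite (le_trans (entry_normM _ _))//; apply: ler_pM; rewrite ?entry_norm_ge0//.
    rewrite (le_trans (locP j jn))//.
    apply: ler_wpM2l; last exact: (x_le _ (ltnW jn)).
    by apply: mulr_ge0 => //; exact: exprn_ge0.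
  rewrite entry_normZ cmodM cmodX gstep//; apply: ler_wpM2l.
    by apply: mulr_ge0; [exact: cmod_ge0|exact: exprn_ge0].
  rewrite (le_trans (entry_normM _ _))// ler_wpM2l ?entry_norm_ge0//.
  rewrite (le_trans (entry_normB _ _))// lerD//.
  rewrite (le_trans (entry_normM _ _))//; apply: ler_pM; rewrite ?entry_norm_ge0//.
  have := nearP (h j) (x j); rewrite gstep// => /(_ delta1) /le_trans; apply.
  apply: ler_wpM2l; last exact: (x_le _ (ltnW jn)).
  exact: mulr_ge0.
(* The leading parts may be subtracted for free, as they sum to [0]. *)
have -> : E (g n - g 0%N) *m x0 - x n =
    \sum_(j < n) (v j - v j.+1 - (c * h j ^+ p.+1) *: (Aq *m v 0%N)).
  rewrite sumrB -scaler_suml -mulr_sumr gsum mulr0 scale0r subr0.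
  rewrite -(big_mkord xpredT (fun j => v j - v j.+1)).
  under eq_bigr do rewrite -opprB.
  rewrite sumrN telescope_sumr// opprB.
  by rewrite /v subrr E0 mul1mx x_0.
rewrite (le_trans (entry_norm_sum _ _ _))//.
apply: (@le_trans _ _ (\sum_(j < n) C4 * entry_norm x0 * delta ^+ p.+2)).
  by apply: ler_sum => j _; exact: v_lead.
rewrite sumr_const card_ord -mulr_natl exprS.
have -> : n%:R * (C4 * entry_norm x0 * (delta * delta ^+ p.+1)) =
   (delta * n%:R) * (C4 * delta ^+ p.+1 * entry_norm x0) by ring.
have -> : T * C4 * delta ^+ p.+1 * entry_norm x0 =
   T * (C4 * delta ^+ p.+1 * entry_norm x0) by ring.
have L_ge0 : 0 <= L by exact: expR_ge0.
have C4_ge0 : 0 <= C4.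
  by rewrite /C4; do ?[assumption | apply: addr_ge0 | apply: mulr_ge0].
apply: ler_wpM2r => //; apply: mulr_ge0; last exact: entry_norm_ge0.
by apply: mulr_ge0 => //; exact: exprn_ge0.
Qed.

End Convergence.

(** * Superconvergence along the arc *)

Theorem theorem4p3 (R : realType) (d s p : nat)
    (hd : (0 < d)%N) (hs : (0 < s)%N) (hp : (0 < p)%N)
    (A : 'M[R[i]]_d) (x0 : 'cV[R[i]]_d) (t0 t : R[i]) (ht : t != t0)
    (m : rk_method R s) (hm : rk_has_order m p) :
  (t0 = gamma_star p t0 t 0 /\ t = gamma_star p t0 t 1) /\
  (fun n : nat =>
     let grid := time_grid (gamma_star p t0 t) n in
     ((max_step grid n)%:C ^+ p)^-1 *:
       (mexp ((t - t0) *: A) *m x0 - grid_function m A grid x0 n))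
    @ \oo --> (0 : 'cV[R[i]]_d).
Proof.
split; first by rewrite gamma_star0// gamma_star1.
pose grid n := time_grid (gamma_star p t0 t) n.
pose delta n := max_step (grid n) n.
have [T [T0 deltaT]] : exists T : R, 0 <= T /\ forall n, (0 < n)%N -> delta n * n%:R <= T.
  exists (cmod ((t0 - t) / (2 * 'i * (sin (pi / p.+1%:R))%:C)) *
    (2 * (2 * pi / p.+1%:R))).
  split=> [|n n0]; last exact: arc_max_step_le.
  by apply: mulr_ge0; [exact: cmod_ge0|rewrite !mulr_ge0 ?pi_ge0].
have delta_ge0 n : (0 < n)%N -> 0 <= delta n.
  by move=> n0; rewrite /delta -(@arc_step_cmod R p t0 t n 0 n0) cmod_ge0.
have delta_cvg (c : R) : c * (T / n%:R) @[n --> \oo] --> (0 : R).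
  rewrite -(mulr0 c) -(mulr0 T); apply: cvgMr; apply: cvgMr.
  apply/gtr0_cvgV0; last exact: cvgr_idn.
  by near=> n; rewrite ltr0n; near: n; exact: nbhs_infty_gt.
have [C [rho [rho0 errP]]] := global_error A hm hp T0.
apply: cvg_entry_norm.
apply: (@squeeze_cvgr _ _ _ _ (fun=> 0)
  (fun n : nat => (`|C| * entry_norm x0) * (T / n%:R))); last exact: delta_cvg.
  near=> n.
  have n1 : (1 < n)%N by near: n; exact: nbhs_infty_gt.
  have n0 : (0 < n)%N by exact: ltnW.
  have delta_le : delta n <= T / n%:R by rewrite ler_pdivlMr ?ltr0n// deltaT.
  have delta_rho : delta n <= rho.
    apply: (le_trans delta_le); rewrite -[leLHS]mul1r; apply: (le_trans (ler_norm _)).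
    rewrite -normrN -[X in `|X|]add0r.
    by near: n; exact: ((cvgrPdist_le _ _).1 (delta_cvg 1) _ rho0).
  have gridn : grid n n = t by rewrite /grid /time_grid divff ?gamma_star1// pnatr_eq0 -lt0n.
  have grid0 : grid n 0%N = t0 by rewrite /grid /time_grid mul0r gamma_star0.
  have := errP (grid n) n (delta n) x0 (fun j _ => @arc_step_cmod R p t0 t n j n0)
    (delta_ge0 n n0) delta_rho (deltaT n n0) (@arc_steps_sum0 R p t0 t n n1).
  rewrite gridn grid0 => err.
  rewrite entry_norm_ge0 sub0r entry_normN entry_normZ cmodV cmodX cmodC.
  rewrite -/(grid n) -/(delta n).
  rewrite ger0_norm ?delta_ge0//=.
  (* A vanishing step size would make the quotient [0], by the convention on
     inverses. *)
  have [d0|dn0] := eqVneq (delta n) 0.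
    rewrite d0 expr0n eqn0Ngt hp invr0 mul0r.
    apply: mulr_ge0; last by rewrite mulr_ge0 ?invr_ge0.
    by rewrite mulr_ge0 ?entry_norm_ge0.
  rewrite ler_pdivrMl ?exprn_gt0 ?lt_def ?dn0 ?delta_ge0// (le_trans err)//.
  have -> : C * delta n ^+ p.+1 * entry_norm x0 = delta n ^+ p * entry_norm x0 * (C * delta n).
    by rewrite exprS; ring.
  have -> : delta n ^+ p * (`|C| * entry_norm x0 * (T / n%:R)) =
     delta n ^+ p * entry_norm x0 * (`|C| * (T / n%:R)) by ring.
  apply: ler_wpM2l; first by rewrite mulr_ge0 ?entry_norm_ge0// exprn_ge0 ?delta_ge0.
  apply: (@le_trans _ _ (`|C| * delta n)); last by rewrite ler_wpM2l.
  by rewrite ler_wpM2r ?delta_ge0// ler_norm.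
exact: cvg_cst.
Unshelve. all: by end_near. Qed.
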